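(* Let $n,m\in\mathbb{N}$, let $A\in\{0,1\}^{n\times m}$ have no zero column, let $\{\mathbf{0}_m,\mathbf{e}_1,\dots,\mathbf{e}_m\}\subseteq X\subseteq\mathbb{R}^m_+$, and let $f:X\times\{0,1\}^n\to\mathbb{R}$ satisfy $f(\mathbf{0}_m,\mathbf{0}_n)=0$. Assume that $f$ is $A$-individually subadditive, i.e. $f(x,w)\le\sum_{j=1}^m f(\mathbf{e}_j,A\mathbf{e}_j)x_j$ for all $(x,w)\in X\times\{0,1\}^n$, and that $f(x,w)$ is monotonically increasing in $w$, i.e. $f(x,w)\le f(x,w')$ whenever $w\le w'$. Let $F(x,w)=\sum_{j=1}^m f(\mathbf{e}_j,A\mathbf{e}_j)x_j$, and for $w\in\{0,1\}^n$ define $$\nu_{X,f}(w)=\max_{x\in X}[f(x,w):Ax\le w],\qquad \nu_{\mathbb{R}^m_+,F}(w)=\max_{x\in\mathbb{R}^m_+}[F(x,w):Ax\le w].$$ Then: (i) $\mathrm{core}(\nu_{X,f})\ne\emptyset$ if and only if $\nu_{X,f}(\mathbf{1}_n)=\nu_{\mathbb{R}^m_+,F}(\mathbf{1}_n)$. (ii) Whenever $\mathrm{core}(\nu_{X,f})$ is non-empty, $$\mathrm{core}(\nu_{X,f})=\operatorname*{arg\,min}_{y\in\mathbb{R}^n_+}\left[\mathbf{1}_n^Ty:\ y^TA\ge(f(\mathbf{e}_1,A\mathbf{e}_1),\dots,f(\mathbf{e}_m,A\mathbf{e}_m))\right].$$ (iii) If $X=\{0,1\}^m$ and $\mathrm{core}(\nu_{X,f})$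 is non-empty, then the linear program $\max_{x\in\mathbb{R}^m_+}[F(x,\mathbf{1}_n):Ax\le\mathbf{1}_n]$ has an integer optimal solution.
   Context: Notation: $\mathbf{0}_n,\mathbf{1}_n$ are the all-zero and all-one vectors in $\mathbb{R}^n$; $\mathbf{e}_j$ is the $j$-th unit vector in $\mathbb{R}^m$; $\mathbb{R}^m_+$ is the set of componentwise non-negative vectors; vector inequalities are componentwise. Standing convention: the maximum defining $\nu_{X,f}(w)$ is attained for every $w\in\{0,1\}^n$. The core of a (revenue) game $\nu:\{0,1\}^n\to\mathbb{R}$ is $\mathrm{core}(\nu)=\{y\in\mathbb{R}^n:\mathbf{1}_n^Ty=\nu(\mathbf{1}_n),\ a^Ty\ge\nu(a)\ \forall a\in\{0,1\}^n\}$. *)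

(* Defs.v *)
From mathcomp Require Import all_boot all_order all_algebra.
From mathcomp Require Export boolp classical_sets reals.

Set Implicit Arguments.
Unset Strict Implicit.
Unset Printing Implicit Defensive.

Import Order.TTheory GRing.Theory Num.Theory.
Local Open Scope ring_scope.
Local Open Scope classical_set_scope.

Section Optimization.
Context {R : realType}.

Definition maxima (S : set R) : set R := S `&` ubound S.

(* The maximum of S; it takes the junk value 0 when S has no greatest element,
   so it is meaningful only if [maxima S] is nonempty. *)
Definition max_of (S : set R) : R := xget 0 (maxima S).

Definition argmin {T : Type} (D : set T) (g : T -> R) : set T :=
  [set y | D y /\ forall z, D z -> g y <= g z].

Definition argmax {T : Type} (D : set T) (g : T -> R) : set T :=
  [set x | D x /\ forall z, D z -> g z <= g x].

End Optimization.

Section RevenueGames.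
Context {R : realType}.

Definition mxle {p q : nat} (u v : 'M[R]_(p, q)) : Prop :=
  forall i j, u i j <= v i j.

Definition nonneg {p : nat} : set 'cV[R]_p := [set x | mxle 0 x].

Definition zero_one {p q : nat} : set 'M[R]_(p, q) :=
  [set u | forall i j, u i j = 0 \/ u i j = 1].

Definition ones {p : nat} : 'cV[R]_p := const_mx 1.

Definition evec {p : nat} (j : 'I_p) : 'cV[R]_p := delta_mx j 0.

Definition dotv {p : nat} (u v : 'cV[R]_p) : R := (u^T *m v) 0 0.

Definition core {n : nat} (nu : 'cV[R]_n -> R) : set 'cV[R]_n :=
  [set y | dotv ones y = nu ones /\
           forall a, zero_one a -> nu a <= dotv a y].

Context {n m : nat}.
Implicit Types (A : 'M[R]_(n, m)) (X : set 'cV[R]_m)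
  (f : 'cV[R]_m -> 'cV[R]_n -> R) (w : 'cV[R]_n).

Definition feasible A X w : set 'cV[R]_m := [set x | X x /\ mxle (A *m x) w].

(* The objective values over which the maximum defining the game is taken.
   A function on X * {0,1}^n is represented by a total f; only its values at
   x in X matter here. *)
Definition feasible_values A X f w : set R :=
  [set f x w | x in feasible A X w].

Definition revenue A X f w : R := max_of (feasible_values A X f w).

Definition unit_values A f : 'rV[R]_m := \row_j f (evec j) (A *m evec j).

Definition linear_ext A f : 'cV[R]_m -> 'cV[R]_n -> R :=
  fun x _ => \sum_(j < m) f (evec j) (A *m evec j) * x j 0.

Definition individually_subadditive A X f : Prop :=
  forall x w, X x -> zero_one w ->
    f x w <= \sum_(j < m) f (evec j) (A *m evec j) * x j 0.

Definition increasing_in_w X f : Prop :=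
  forall x w w', X x -> zero_one w -> zero_one w' ->
    mxle w w' -> f x w <= f x w'.

End RevenueGames.

(* Main.v *)
Require Import Defs.
From mathcomp Require Import all_boot all_order all_algebra.
From mathcomp Require Import boolp classical_sets reals.
From mathcomp Require Import lra.

Set Implicit Arguments.
Unset Strict Implicit.
Unset Printing Implicit Defensive.

Import Order.TTheory GRing.Theory Num.Theory.
Local Open Scope ring_scope.
Local Open Scope classical_set_scope.

(** Write [c] for the vector of the values [f (evec j) (A *m evec j)] and [nu]
    for the revenue game of [f] on [X].  The core of [nu] is the set of
    [y >= 0] with [A^T y >= c] and total [nu 1] ([core_revenueP]).  Indeed, a
    core vector satisfies [y i >= nu (evec i) >= f 0 0 = 0] and
    [(A^T y) j >= nu (A e_j) >= c j]; conversely, if [x] attains [nu w], then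
    subadditivity and weak duality give
    [nu w = f x w <= c.x <= y.(A x) <= y.w].

    The core is therefore the set of feasible solutions of the linear program
    [min 1.y : y >= 0, A^T y >= c] whose value is [nu 1].  The point of [X]
    that attains [nu 1] is feasible for the program
    [max c.x : x >= 0, A x <= 1] and has value at least [nu 1], so, as soon as
    the core is nonempty, weak duality makes this point and every core vector
    optimal for the two programs, with common value [nu 1]
    ([core_certifies_optimum]).  This gives the forward implication of the
    first claim and the other two claims.

    The reverse implication needs strong duality ([strong_duality]): an optimal
    dual solution has total [nu 1] when [nu 1] is the value of the program.
    The maximization program is feasible at [0], and the minimization program is
    feasible because [A] is a zero-one matrix without zero column.  Strong duality is obtained from the inequalities for a pair
    [(x, y)] that express feasibility of [x] and [y] and absence of a duality
    gap: if they had no solution, Fourier-Motzkin elimination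
    ([fourier_motzkin]) would produce a nonnegative combination of them reading
    [0 <= d] with [d < 0], which weak duality and the feasibility of the two
    programs exclude. *)

(** * Fourier-Motzkin elimination *)

(** Finite sets of lower and upper bounds, either of which may be empty. *)
Lemma exists_between (R : realFieldType) (L U : seq R) :
  (forall l u, l \in L -> u \in U -> l <= u) ->
  exists t, (forall l, l \in L -> l <= t) /\ (forall u, u \in U -> t <= u).
Proof.
elim: L => [_|l L IH LU].
  elim: U => [|u U [t [_ tU]]]; first by exists 0.
  exists (Num.min u t); split=> // v; rewrite inE ge_min => /predU1P[->|/tU ->].
    by rewrite lexx.
  by rewrite orbT.
have [l' u l'L uU|t [Lt tU]] := IH; first by apply: LU; rewrite // inE l'L orbT.
exists (Num.max l t); split=> [k|u uU].
  by rewrite inE le_max => /predU1P[->|/Lt ->]; rewrite ?lexx ?orbT.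
by rewrite ge_max tU // LU // mem_head.
Qed.

(** The pair [(a, b)] encodes the linear inequality [a x <= b]. *)
Definition satisfies (R : realFieldType) N (x : 'cV[R]_N) (p : 'rV[R]_N * R) :=
  (p.1 *m x) 0 0 <= p.2.

Lemma satisfies_shift (R : realFieldType) N (x : 'cV[R]_N) (p : 'rV[R]_N * R)
    (j : 'I_N) (t : R) :
  satisfies (x + t *: delta_mx j 0) p <-> (p.1 *m x) 0 0 + t * p.1 0 j <= p.2.
Proof.
by rewrite /satisfies mulmxDr -scalemxAr -colE !mxE.
Qed.

(** Theorem of the alternative for a finite system [S] of linear inequalities.
    The predicate [K] stands for any set of inequalities that contains [S] and
    is closed under nonnegative combinations, so that an inconsistent [S] yields
    in [K] the absurd inequality [0 <= b] with [b < 0].  The number of unknowns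
    stays fixed: an unknown counts as eliminated once its coefficient is zero in
    every inequality. *)
Lemma fourier_motzkin (R : realFieldType) N (K : 'rV[R]_N * R -> Prop)
    (K_add : forall p q, K p -> K q -> K (p.1 + q.1, p.2 + q.2))
    (K_scale : forall s p, 0 <= s -> K p -> K (s *: p.1, s * p.2))
    (S : seq ('rV[R]_N * R)) (SK : forall p, p \in S -> K p) :
  (exists x, forall p, p \in S -> satisfies x p) \/
  (exists2 b, b < 0 & K (0, b)).
Proof.
have elim_from k : forall S : seq ('rV[R]_N * R), (forall p, p \in S -> K p) ->
    (forall p, p \in S -> forall j : 'I_N, (k <= j)%N -> p.1 0 j = 0) ->
    (exists x, forall p, p \in S -> satisfies x p) \/
    (exists2 b, b < 0 & K (0, b)); last first.
  by apply: (elim_from N S SK) => p _ j; rewrite leqNgt ltn_ord.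
elim: k => [|k IH] {SK}S SK S0.
  have a0 p : p \in S -> p.1 = 0.
    by move=> pS; apply/rowP => j; rewrite S0 // mxE.
  have [/hasP[p pS p_lt0]|/hasPn S_ge0] := boolP (has (fun p => p.2 < 0) S).
    by right; exists p.2 => //; rewrite -(a0 _ pS) -surjective_pairing; exact: SK.
  left; exists 0 => p pS.
  by rewrite /satisfies mulmx0 mxE leNgt S_ge0.
have [Nk|kN] := leqP N k.
  by apply: IH => // p pS j kj; have := ltn_ord j; rewrite ltnNge (leq_trans Nk).
pose j0 := Ordinal kN.
pose Sp : seq ('rV[R]_N * R) := [seq p : 'rV[R]_N * R <- S | 0 < p.1 0 j0].
pose Sn : seq ('rV[R]_N * R) := [seq p : 'rV[R]_N * R <- S | p.1 0 j0 < 0].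
(* Cross-multiplying with positive factors makes the coefficient of the
   eliminated variable cancel. *)
pose comb (p q : 'rV[R]_N * R) :=
  ((- q.1 0 j0) *: p.1 + p.1 0 j0 *: q.1, (- q.1 0 j0) * p.2 + p.1 0 j0 * q.2).
pose S' := [seq p : 'rV[R]_N * R <- S | p.1 0 j0 == 0] ++
           [seq comb p q | p <- Sp, q <- Sn].
have S'P p : p \in S' -> K p /\ forall j : 'I_N, (k <= j)%N -> p.1 0 j = 0.
  rewrite mem_cat => /orP[|/allpairsP[[p1 q1] /= [p1S q1S ->]]].
    rewrite mem_filter => /andP[/eqP p0 pS]; split; first exact: SK.
    move=> j; rewrite leq_eqVlt => /predU1P[kj|]; last exact: S0.
    by rewrite (_ : j = j0) //; apply: val_inj.
  move: p1S q1S; rewrite !mem_filter => /andP[p1_gt0 p1S] /andP[q1_lt0 q1S].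
  split; first apply: (K_add (_, _) (_, _)).
  - by apply: K_scale; [rewrite oppr_ge0 ltW|exact: SK].
  - by apply: K_scale; [rewrite ltW|exact: SK].
  move=> j; rewrite !mxE leq_eqVlt => /predU1P[kj|kj].
    by rewrite (_ : j = j0) ?mulNr 1?mulrC ?addNr //; apply: val_inj.
  by rewrite (S0 _ p1S j) // (S0 _ q1S j) // !mulr0 addr0.
have [p /S'P[]//|p /S'P[]//|[x xS']|] := IH S'; [|by right].
left.
(* The bound that p puts on a step along the unknown j0 away from x: an upper
   bound for p in Sp, a lower bound for p in Sn. *)
pose bound (p : 'rV[R]_N * R) := (p.2 - (p.1 *m x) 0 0) / p.1 0 j0.
have [l u|t [lt tu]] := @exists_between _ (map bound Sn) (map bound Sp).
  move=> /mapP[q qS ->] /mapP[p pS ->].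
  have : satisfies x (comb p q).
    by apply: xS'; rewrite mem_cat; apply/orP; right; apply/allpairsP; exists (p, q).
  move: pS qS; rewrite !mem_filter => /andP[p_gt0 _] /andP[q_lt0 _].
  rewrite /satisfies /bound /= mulmxDl -!scalemxAl !mxE.
  rewrite ler_ndivrMr // mulrAC ler_pdivrMr // => le_comb.
  lra.
exists (x + t *: delta_mx j0 0) => p pS; apply/satisfies_shift.
have [p_lt0|p_gt0|p0] := ltgtP (p.1 0 j0) 0.
- have /lt : bound p \in map bound Sn by apply: map_f; rewrite mem_filter p_lt0.
  by rewrite ler_ndivrMr // lerBrDl.
- have /tu : bound p \in map bound Sp by apply: map_f; rewrite mem_filter p_gt0.
  by rewrite ler_pdivlMr // lerBrDl.
- by rewrite p0 mulr0 addr0; apply: xS'; rewrite mem_cat mem_filter p0 eqxx pS.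
Qed.

(** * Scalar products and componentwise inequalities *)

Section VectorInequalities.
Context (R : realType).

Lemma dotvE p (u v : 'cV[R]_p) : dotv u v = \sum_i u i 0 * v i 0.
Proof. by rewrite /dotv mxE; apply: eq_bigr => i _; rewrite mxE. Qed.

Lemma dotvC p (u v : 'cV[R]_p) : dotv u v = dotv v u.
Proof. by rewrite !dotvE; apply: eq_bigr => i _; rewrite mulrC. Qed.

Lemma dotv0 p (u : 'cV[R]_p) : dotv u 0 = 0.
Proof. by rewrite /dotv mulmx0 mxE. Qed.

Lemma dotvDr p (u v w : 'cV[R]_p) : dotv u (v + w) = dotv u v + dotv u w.
Proof. by rewrite /dotv mulmxDr mxE. Qed.

Lemma dotvZr p s (u v : 'cV[R]_p) : dotv u (s *: v) = s * dotv u v.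
Proof. by rewrite /dotv -scalemxAr mxE. Qed.

Lemma dotvZl p s (u v : 'cV[R]_p) : dotv (s *: u) v = s * dotv u v.
Proof. by rewrite !(dotvC _ v) dotvZr. Qed.

Lemma dotv_evec p (u : 'cV[R]_p) i : dotv u (evec i) = u i 0.
Proof. by rewrite /dotv -colE !mxE. Qed.

Lemma dotv_adjoint p q (A : 'M[R]_(p, q)) u v :
  dotv u (A *m v) = dotv (A^T *m u) v.
Proof. by rewrite /dotv trmx_mul trmxK mulmxA. Qed.

Lemma ler_dotv p (u v w : 'cV[R]_p) :
  nonneg w -> mxle u v -> dotv u w <= dotv v w.
Proof.
move=> w0 uv; rewrite !dotvE; apply: ler_sum => i _.
by apply: ler_wpM2r (uv i 0); have := w0 i 0; rewrite mxE.
Qed.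

Lemma nonneg_evec p (i : 'I_p) : nonneg (evec i : 'cV[R]_p).
Proof. by move=> j k; rewrite !mxE ler0n. Qed.

Lemma nonnegD p (u v : 'cV[R]_p) : nonneg u -> nonneg v -> nonneg (u + v).
Proof.
move=> u0 v0 i j; rewrite !mxE.
by apply: addr_ge0; [have := u0 i j|have := v0 i j]; rewrite mxE.
Qed.

Lemma nonnegZ p s (u : 'cV[R]_p) : 0 <= s -> nonneg u -> nonneg (s *: u).
Proof.
move=> s0 u0 i j; rewrite !mxE; apply: mulr_ge0 => //.
by have := u0 i j; rewrite mxE.
Qed.

End VectorInequalities.

(** * Linear programming duality *)

Section LinearProgramming.
Context (R : realType) (n m : nat).
Implicit Types (A : 'M[R]_(n, m)) (b y : 'cV[R]_n) (c x : 'cV[R]_m).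

(** The feasible set of [min b.y : y >= 0, A^T y >= c], the dual of
    [max c.x : x >= 0, A x <= b]. *)
Definition dual_feasible A c : set 'cV[R]_n :=
  [set y | nonneg y /\ mxle c (A^T *m y)].

(** Weak duality with both right-hand sides scaled by the same [t]: the form
    needed when the multiplier [t] of an inequality has not been normalized. *)
Lemma scaled_weak_duality A b c t x y : nonneg x -> nonneg y ->
  mxle (A *m x) (t *: b) -> mxle (t *: c) (A^T *m y) ->
  t * dotv c x <= t * dotv b y.
Proof.
move=> x0 y0 Axb cAy; rewrite -!dotvZl.
apply: le_trans (ler_dotv x0 cAy) _.
by rewrite -dotv_adjoint dotvC ler_dotv.
Qed.

Lemma weak_duality A b c x y :
  feasible A nonneg b x -> dual_feasible A c y -> dotv c x <= dotv b y.
Proof.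
move=> [x0 Axb] [y0 cAy]; have := @scaled_weak_duality A b c 1 x y.
by rewrite !scale1r !mul1r; apply.
Qed.

(** The inequalities on [col_mx x y] that follow from the system
      [A x <= b], [A^T y >= c], [b.y <= c.x], [x >= 0], [y >= 0]
    by combining its first three groups with multipliers [u], [v], [t] and then
    weakening the coefficients, as the sign constraints on [x] and [y] allow. *)
Definition duality_consequence A b c (p : 'rV[R]_(m + n) * R) : Prop :=
  exists u v t, [/\ nonneg u, nonneg v, 0 <= t,
    mxle p.1 (col_mx (A^T *m u - t *: c) (t *: b - A *m v))^T
    & p.2 = dotv b u - dotv c v].

(** Only the inequality [b.y <= c.x] is stated, the converse being
    [weak_duality]. *)
Lemma strong_duality A b c :
  feasible A nonneg b !=set0 -> dual_feasible A c !=set0 ->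
  exists x y, [/\ feasible A nonneg b x, dual_feasible A c y
                & dotv b y <= dotv c x].
Proof.
move=> [x1 [x1_ge0 Ax1]] [y1 [y1_ge0 cAy1]].
pose K := duality_consequence A b c.
have K_add p q : K p -> K q -> K (p.1 + q.1, p.2 + q.2).
  move=> [u [v [t [u0 v0 t0 pK ->]]]] [u' [v' [t' [u'0 v'0 t'0 qK ->]]]].
  exists (u + u'), (v + v'), (t + t'); split => //=.
  - exact: nonnegD.
  - exact: nonnegD.
  - exact: addr_ge0.
  - move=> i j; rewrite !mulmxDr !scalerDl !opprD addrACA.
    rewrite [X in col_mx _ X]addrACA -add_col_mx linearD mxE [leRHS]mxE.
    exact: lerD.
  - by rewrite !dotvDr opprD addrACA.
have K_scale s p : 0 <= s -> K p -> K (s *: p.1, s * p.2).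
  move=> s0 [u [v [t [u0 v0 t0 pK ->]]]].
  exists (s *: u), (s *: v), (s * t); split => //=.
  - exact: nonnegZ.
  - exact: nonnegZ.
  - exact: mulr_ge0.
  - move=> i j; rewrite -!scalemxAr -!scalerA -!scalerBr -scale_col_mx linearZ.
    by rewrite mxE [leRHS]mxE ler_wpM2l.
  - by rewrite !dotvZr mulrBr.
pose primal i : 'rV[R]_(m + n) * R := (row_mx (row i A) 0, b i 0).
pose dual j : 'rV[R]_(m + n) * R := (row_mx 0 (- (col j A)^T), - c j 0).
pose gap : 'rV[R]_(m + n) * R := (row_mx (- c^T) b^T, 0).
pose sign k : 'rV[R]_(m + n) * R := (- delta_mx 0 k, 0).
pose S := gap :: map primal (enum 'I_n) ++ map dual (enum 'I_m)
              ++ map sign (enum 'I_(m + n)).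
have SK p : p \in S -> K p.
  rewrite inE !mem_cat => /or4P[/eqP->|/mapP[i _ ->]|/mapP[j _ ->]|/mapP[k _ ->]].
  - exists 0, 0, 1; split; rewrite ?ler01 ?dotv0 ?subr0 //.
    by rewrite !mulmx0 !scale1r sub0r subr0 tr_col_mx linearN.
  - exists (evec i), 0, 0; split; rewrite ?dotv_evec ?dotv0 ?subr0 //.
      exact: nonneg_evec.
    by rewrite mulmx0 !scale0r !subr0 -colE tr_col_mx tr_col trmxK trmx0.
  - exists 0, (evec j), 0; split; rewrite ?dotv_evec ?dotv0 ?sub0r //.
      exact: nonneg_evec.
    by rewrite mulmx0 !scale0r subrr -colE sub0r tr_col_mx trmx0 linearN.
  - exists 0, 0, 0; split; rewrite ?dotv0 ?subr0 //.
    move=> i j; rewrite !mulmx0 !scale0r !subr0 col_mx0 trmx0 !mxE.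
    by rewrite oppr_le0 ler0n.
have [[z zS]|[d d_lt0 [u [v [t [u0 v0 t0]]]]]] := fourier_motzkin K_add K_scale SK.
  exists (usubmx z), (dsubmx z).
  have zE : z = col_mx (usubmx z) (dsubmx z) by rewrite vsubmxK.
  have z0 k : 0 <= z k 0.
    have := zS (sign k); rewrite !inE !mem_cat map_f ?mem_enum ?orbT //.
    by rewrite /satisfies /= mulNmx -rowE !mxE oppr_le0; apply.
  split; first split.
  - by move=> i j; rewrite ord1 !mxE.
  - move=> i j; rewrite ord1.
    have := zS (primal i); rewrite !inE !mem_cat map_f ?mem_enum ?orbT //.
    rewrite /satisfies zE mul_row_col mul0mx addr0 -row_mul mxE col_mxKu.
    by apply.
  - split; first by move=> i j; rewrite ord1 !mxE.
    move=> j i; rewrite ord1.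
    have := zS (dual j); rewrite !inE !mem_cat map_f ?mem_enum ?orbT //.
    rewrite /satisfies zE mul_row_col mul0mx add0r mulNmx tr_col -row_mul col_mxKd.
    by rewrite mxE lerN2 mxE; apply.
  - have := zS gap; rewrite mem_head => /(_ isT).
    rewrite /satisfies [X in _ *m X]zE mul_row_col mulNmx addrC mxE [X in _ + X]mxE.
    by rewrite subr_le0.
(* For an inconsistent system, the multipliers satisfy A^T u >= t c,
   A v <= t b and b.u < c.v; this is refuted separately for t > 0 and t = 0. *)
move=> /= K0 dE.
have cAu : mxle (t *: c) (A^T *m u).
  move=> j i; rewrite ord1; have := K0 0 (lshift n j).
  by rewrite mxE [leRHS]mxE col_mxEu [leRHS]mxE [X in _ + X]mxE subr_ge0.
have Avb : mxle (A *m v) (t *: b).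
  move=> j i; rewrite ord1; have := K0 0 (rshift m j).
  by rewrite mxE [leRHS]mxE col_mxEd [leRHS]mxE [X in _ + X]mxE subr_ge0.
move: d_lt0; rewrite dE subr_lt0 ltNge => /negP[].
move: t0; rewrite le_eqVlt => /predU1P[t0|t_gt0]; last first.
  rewrite -(ler_pM2l t_gt0); exact: scaled_weak_duality v0 u0 Avb cAu.
move: cAu Avb; rewrite -t0 !scale0r => Au0 Av0.
(* c.v <= y1.(A v) <= 0 <= u.(A x1) <= b.u *)
have cv : dotv c v <= 0.
  apply: le_trans (ler_dotv v0 cAy1) _.
  rewrite -dotv_adjoint dotvC; apply: le_trans (ler_dotv y1_ge0 Av0) _.
  by rewrite dotvC dotv0.
have bu : 0 <= dotv b u.
  apply: le_trans (ler_dotv u0 Ax1).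
  rewrite dotvC dotv_adjoint; apply: le_trans (ler_dotv x1_ge0 Au0).
  by rewrite dotvC dotv0.
exact: le_trans cv bu.
Qed.

End LinearProgramming.

(** * The core of the revenue game *)

Section Maxima.
Context (R : realType).

Lemma maxima_max_of (S : set R) : maxima S !=set0 -> maxima S (max_of S).
Proof. exact: xgetPex. Qed.

Lemma max_of_eq (S : set R) s : maxima S s -> max_of S = s.
Proof.
move=> Ss; have [St tS] : maxima S (max_of S) by apply: maxima_max_of; exists s.
by apply/eqP; rewrite eq_le Ss.2 // tS //; exact: Ss.1.
Qed.

End Maxima.

Section RevenueGame.
Context (R : realType) (n m : nat) (A : 'M[R]_(n, m)).
Context (X : set 'cV[R]_m) (f : 'cV[R]_m -> 'cV[R]_n -> R).
Implicit Types (x : 'cV[R]_m) (w y : 'cV[R]_n).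

Let c := (unit_values A f)^T.

Lemma linear_extE x w : linear_ext A f x w = dotv c x.
Proof. by rewrite dotvE; apply: eq_bigr => j _; rewrite !mxE. Qed.

Lemma unit_values_dualP y :
  mxle (unit_values A f) (y^T *m A) <-> mxle c (A^T *m y).
Proof.
have -> : A^T *m y = (y^T *m A)^T by rewrite trmx_mul trmxK.
by split=> le_c i j; have := le_c j i; rewrite !mxE.
Qed.

Lemma zero_one_evec p (i : 'I_p) : zero_one (evec i : 'cV[R]_p).
Proof. by move=> j k; rewrite mxE; case: (_ && _); [right|left]. Qed.

Lemma zero_one_ones p : zero_one (ones : 'cV[R]_p).
Proof. by move=> j k; rewrite mxE; right. Qed.

Lemma zero_one0 p : zero_one (0 : 'cV[R]_p).
Proof. by move=> j k; rewrite mxE; left. Qed.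

Lemma zero_one_ge0 p q (B : 'M[R]_(p, q)) : zero_one B -> mxle 0 B.
Proof. by move=> B01 i j; rewrite mxE; case: (B01 i j) => ->; rewrite ?ler01. Qed.

Context (A01 : zero_one A).

Lemma zero_one_column j : zero_one (A *m evec j).
Proof. by move=> i k; rewrite -colE mxE; exact: A01. Qed.

Context (X0 : X 0) (Xe : forall j : 'I_m, X (evec j)).
Context (X_nonneg : X `<=` nonneg) (f00 : f 0 0 = 0).
Context (f_sub : individually_subadditive A X f).
Context (f_mono : increasing_in_w X f).
Context (max_attained : forall w : 'cV[R]_n, zero_one w ->
  maxima (feasible_values A X f w) !=set0).

Lemma revenue_attained w : zero_one w ->
  exists2 x, feasible A X w x & revenue A X f w = f x w.
Proof. by move=> /max_attained/maxima_max_of[[x xP fx] _]; exists x. Qed.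

Lemma le_revenue w x : zero_one w -> feasible A X w x -> f x w <= revenue A X f w.
Proof.
by move=> /max_attained/maxima_max_of[_ ub] xP; apply: ub; exists x.
Qed.

Lemma feasible_nonneg w x : feasible A X w x -> feasible A nonneg w x.
Proof. by case=> /X_nonneg. Qed.

Lemma objective_le_linear w x : zero_one w -> X x -> f x w <= dotv c x.
Proof. by move=> w01 Xx; rewrite -(linear_extE x w) f_sub. Qed.

(** The values of the game on the unit vectors and on the columns of [A] already
    determine its core, besides the total [nu 1]. *)
Lemma core_revenueP y :
  core (revenue A X f) y <->
  dual_feasible A c y /\ dotv ones y = revenue A X f ones.
Proof.
split=> [[y1 yP]|[cAy y1]].
  split=> //; split.
    move=> i k; rewrite ord1 mxE -(dotv_evec y i) dotvC.
    apply: le_trans (yP _ (zero_one_evec i)).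
    have e01 := zero_one_evec i.
    apply: (@le_trans _ _ (f 0 (evec i))); last first.
      by apply: le_revenue => //; split; rewrite ?mulmx0 //; exact: zero_one_ge0.
    by rewrite -f00 f_mono //; [exact: zero_one0|exact: zero_one_ge0].
  move=> j k; rewrite ord1.
  have -> : (A^T *m y) j 0 = dotv (A *m evec j) y.
    by rewrite dotvC dotv_adjoint dotv_evec.
  have Aj01 := zero_one_column j.
  apply: le_trans (yP _ Aj01).
  by rewrite !mxE; apply: le_revenue => //; split.
split=> // w w01.
have [x xP ->] := revenue_attained w01.
apply: le_trans (objective_le_linear w01 xP.1) _.
exact: weak_duality (feasible_nonneg xP) cAy.
Qed.

(** When the core is nonempty, a point of [X] that attains the value of the grand
    coalition solves the linear program over the whole nonnegative orthant. *)
Lemma core_certifies_optimum : core (revenue A X f) !=set0 ->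
  exists x, [/\ feasible A X ones x,
    argmax (feasible A nonneg ones) (fun x => linear_ext A f x ones) x
    & dotv c x = revenue A X f ones].
Proof.
move=> [y /core_revenueP[cAy y1]].
have [x xP fx] := revenue_attained (@zero_one_ones n).
have cx_ge : revenue A X f ones <= dotv c x.
  by rewrite fx; apply: objective_le_linear xP.1; exact: zero_one_ones.
have c_le z : feasible A nonneg ones z -> dotv c z <= revenue A X f ones.
  by move=> zP; rewrite -y1; exact: weak_duality zP cAy.
exists x; split=> //.
  split=> [|z zP]; first exact: feasible_nonneg.
  by rewrite !linear_extE (le_trans (c_le z zP)).
by apply/eqP; rewrite eq_le cx_ge c_le //; exact: feasible_nonneg.
Qed.

(** An optimal solution exists by hypothesis, so that the maximum defining the
    left-hand side is not the default value. *)
Lemma lp_revenueE x :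
  argmax (feasible A nonneg ones) (fun x => linear_ext A f x ones) x ->
  revenue A nonneg (linear_ext A f) ones = dotv c x.
Proof.
move=> [xP x_max]; apply: max_of_eq; split.
  by exists x; rewrite ?linear_extE.
by move=> _ [z zP <-]; rewrite -(linear_extE x ones); exact: x_max.
Qed.

Context (A_col : forall j : 'I_m, col j A != 0).

Lemma dual_feasible_nonempty : dual_feasible A c !=set0.
Proof.
pose s := \sum_j `|c j 0|; have s0 : 0 <= s by apply: sumr_ge0.
have A0 := zero_one_ge0 A01.
(* Each column of A contains a 1, so every component of A^T (s *: ones) is at
   least s. *)
exists (s *: ones); split=> [i k|j k].
  by rewrite !mxE mulr1.
rewrite ord1; apply: (@le_trans _ _ s).
  apply: le_trans (ler_norm _) _.
  by rewrite /s (bigD1 j) //= lerDl sumr_ge0.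
have /cV0Pn[i Aij] := A_col j; rewrite mxE in Aij.
have Aij1 : A i j = 1 by case: (A01 i j) => // A0'; rewrite A0' eqxx in Aij.
rewrite mxE (bigD1 i) //= !mxE Aij1 mul1r mulr1 lerDl.
apply: sumr_ge0 => l _; rewrite !mxE mulr1 mulr_ge0 //.
by have := A0 l j; rewrite mxE.
Qed.

Lemma lp_strong_duality : exists x y,
  [/\ argmax (feasible A nonneg ones) (fun x => linear_ext A f x ones) x,
      dual_feasible A c y & dotv ones y = dotv c x].
Proof.
have [||x [y [xP yP yx]]] := @strong_duality R n m A ones c.
- by exists 0; split; rewrite ?mulmx0 //; exact: zero_one_ge0 (@zero_one_ones n).
- exact: dual_feasible_nonempty.
exists x, y; split=> //.
  split=> // z zP; rewrite !linear_extE.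
  exact: le_trans (weak_duality zP yP) yx.
by apply/eqP; rewrite eq_le yx (weak_duality xP yP).
Qed.

End RevenueGame.

Theorem theorem9 (R : realType) (n m : nat) (A : 'M[R]_(n, m))
    (X : set 'cV[R]_m) (f : 'cV[R]_m -> 'cV[R]_n -> R)
    (A01 : zero_one A)
    (A_col : forall j : 'I_m, col j A != 0)
    (X0 : X 0)
    (Xe : forall j : 'I_m, X (evec j))
    (X_nonneg : X `<=` nonneg)
    (f00 : f 0 0 = 0)
    (f_sub : individually_subadditive A X f)
    (f_mono : increasing_in_w X f)
    (max_attained : forall w : 'cV[R]_n, zero_one w ->
       maxima (feasible_values A X f w) !=set0) :
  [/\ core (revenue A X f) !=set0 <->
        revenue A X f ones = revenue A nonneg (linear_ext A f) ones,
      core (revenue A X f) !=set0 ->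
        core (revenue A X f) =
        argmin [set y : 'cV[R]_n | nonneg y /\ mxle (unit_values A f) (y^T *m A)]
               (fun y => dotv ones y)
    & X = zero_one -> core (revenue A X f) !=set0 ->
        exists2 x : 'cV[R]_m,
          argmax (feasible A nonneg ones) (fun x => linear_ext A f x ones) x
          & forall j : 'I_m, x j 0 \is a Num.int].
Proof.
have coreP := core_revenueP A01 X0 Xe X_nonneg f00 f_sub f_mono max_attained.
have certificate :=
  core_certifies_optimum A01 X0 Xe X_nonneg f00 f_sub f_mono max_attained.
split.
- split=> [/certificate[x [_ x_opt <-]]|nuE]; first by rewrite (lp_revenueE x_opt).
  have [x [y [x_opt yP yx]]] := lp_strong_duality f A01 A_col.
  by exists y; apply/coreP; rewrite nuE (lp_revenueE x_opt).
- move=> core_n0; have [x [xP _ cx]] := certificate core_n0.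
  have [y0 y0_core] := core_n0.
  have [y0P y01] := (coreP y0).1 y0_core.
  have -> : [set y | nonneg y /\ mxle (unit_values A f) (y^T *m A)] =
      dual_feasible A (unit_values A f)^T.
    by apply/seteqP; split=> y [y_ge0 /unit_values_dualP].
  apply/seteqP; split=> y.
    move=> /coreP[yP y1]; split=> // z zP.
    by rewrite y1 -cx; exact: weak_duality (feasible_nonneg X_nonneg xP) zP.
  move=> [yP y_min]; apply/coreP; split=> //.
  apply/eqP; rewrite eq_le -{1}y01 y_min //= -cx.
  exact: weak_duality (feasible_nonneg X_nonneg xP) yP.
- move=> XE /certificate[x [[Xx _] x_opt _]]; exists x => // j.
  move: Xx; rewrite XE => /(_ j 0)[] ->.
    exact: rpred0.
  exact: rpred1.
Qed.
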